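(* There is a universal constant $c>0$ such that the following holds. Let $k\in\mathbb{N}$, $k\ge1$, and let $J_1,\dots,J_k$ be $n\times n$ interaction matrices with disjoint supports such that $\|J_i\|_\infty\le1$ and $\|J_i\|_F\ge k$ for all $i$. Define $\mathcal{J}=\{J=\sum_i\alpha_iJ_i:\alpha_i\in\mathbb{R},\ \|J\|_\infty\le1\}$. Then any one-sample estimator $\hat J=\hat J(x)$ satisfies $$\sup_{J^*\in\mathcal{J}}\mathbb{E}_{x\sim\Pr_{J^*}}\big[\|\hat J-J^*\|_F\big]\ge c\sqrt k.$$
   Context: An interaction matrix is a real symmetric $n\times n$ matrix $J$ with zero diagonal. The Ising model $\Pr_J$ is the distribution on $\{\pm1\}^n$ with $\Pr_J[x]\propto\exp(x^\top Jx/2)$. $\|J\|_\infty=\max_i\sum_j|J_{ij}|$ and $\|\cdot\|_F$ is the Frobenius norm. The support of a matrix is the set of its non-zero entries (positions). A one-sample estimator is any function from $\{\pm1\}^n$ to $\mathbb{R}^{n\times n}$. *)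

(* Defs.v *)
From HB Require Import structures.
From mathcomp Require Import all_boot all_order all_algebra.
From mathcomp Require Import all_classical all_reals all_analysis.

Set Implicit Arguments.
Unset Strict Implicit.
Unset Printing Implicit Defensive.

Import Order.TTheory GRing.Theory Num.Theory.

Local Open Scope classical_set_scope.
Local Open Scope ring_scope.

Definition is_interaction_mx (R : realType) (n : nat) (J : 'M[R]_n) : Prop :=
  J^T = J /\ forall i : 'I_n, J i i = 0.

(* Maximal absolute row sum; the default 0 only matters for n = 0. *)
Definition norm_inf (R : realType) (n : nat) (J : 'M[R]_n) : R :=
  \big[Num.max/0]_(i < n) \sum_(j < n) `|J i j|.

Definition norm_frob (R : realType) (n : nat) (J : 'M[R]_n) : R :=
  Num.sqrt (\sum_(i < n) \sum_(j < n) J i j ^+ 2).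

Definition mx_support (R : realType) (n : nat) (J : 'M[R]_n) :
  {set 'I_n * 'I_n} := [set p | J p.1 p.2 != 0]%SET.

(* {+1,-1}^n is encoded by bits: false stands for +1 and true for -1. *)
Definition config (n : nat) : finType := {ffun 'I_n -> bool}.

Definition spins (R : realType) (n : nat) (x : config n) : 'cV[R]_n :=
  \col_(i < n) (-1) ^+ x i.

Definition ising_weight (R : realType) (n : nat) (J : 'M[R]_n)
    (x : config n) : R :=
  expR (((spins R x)^T *m J *m spins R x) 0 0 / 2).

Definition ising_prob (R : realType) (n : nat) (J : 'M[R]_n)
    (x : config n) : R :=
  ising_weight J x / \sum_(y : config n) ising_weight J y.

Definition ising_expectation (R : realType) (n : nat) (J : 'M[R]_n)
    (f : config n -> R) : R :=
  \sum_(x : config n) ising_prob J x * f x.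

Definition ising_family (R : realType) (n k : nat) (J : 'I_k -> 'M[R]_n) :
  set 'M[R]_n :=
  [set A | (exists alpha : 'I_k -> R, A = \sum_(i < k) alpha i *: J i) /\
           norm_inf A <= 1].

(* Main.v *)
Require Import Defs.
From HB Require Import structures.
From mathcomp Require Import all_boot all_order all_algebra.
From mathcomp Require Import all_classical all_reals all_analysis.
From mathcomp Require Import ring lra.

Set Implicit Arguments.
Unset Strict Implicit.
Unset Printing Implicit Defensive.

Import Order.TTheory GRing.Theory Num.Theory.

Local Open Scope classical_set_scope.
Local Open Scope ring_scope.

(** Sign vectors [s] index the hypotheses [J_s = 1/8 * \sum_i s_i U_i], where
    [U_i = J_i / |J_i|_F].  Since [|J_i|_oo <= 1] and [|J_i|_F >= k], each
    [J_s] has [|J_s|_oo <= 1/8]; since the supports are disjoint, the [U_i] are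
    orthonormal for the Frobenius inner product, so [|J_s|_F^2 = k / 64] and
    flipping one sign moves [J_s] by the constant distance [1/4].  An Assouad
    argument over the hypercube then yields an error of order [sqrt k], as soon
    as neighbouring measures [Pr_(J_s)] are hard to tell apart.

    Bounding the divergence between one given pair of neighbours would need
    a bound on the variance of the quadratic form [x^T U_i x].  It is enough,
    however, to bound the average over all edges of the hypercube, and this
    average is a mean energy ([sum_sym_kl]).  Log-likelihood ratios across the
    edge [i] are [s_i x^T B_i x] up to a constant, with [B_i = U_i / 8], so the
    symmetrized divergence is a difference of two means of [x^T B_i x], and
    reindexing by the flip turns the sum over all edges into
    [2 \sum_s E_s(x^T J_s x)].  Only the mean energy has to be controlled.

    The mean energy is at most [3 |J|_F^2] when [|J|_oo <= 1/8]
    ([expect_quad_le]).  Let [h = J x] be the local field and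
    [t_i = E(x_i | x_j, j <> i)], so that [|t_i| <= 2 |h_i|].  Replacing one
    factor [x_i] of [|h|^2 = \sum_(r, i) J_ri x_i h_r] by [t_i] costs
    the diagonal contribution [\sum J_ri^2 = |J|_F^2], and what remains,
    [h^T J t], is at most a small multiple of [|h|^2] because
    [|J|_oo] is small.  Hence [E |h|^2] is of order [|J|_F^2], and so is
    [E(x^T J x) = E(t . h)].

    The divergences thus add up to at most a tenth of the number of pairs
    [(s, i)], and [assouad_kl] with [sum_mxdot_le] (the [l^1] norm of the
    coordinates along the [U_i] is at most [sqrt k] times the Frobenius norm)
    bounds the error averaged over all [s] below by [sqrt k / 16]. *)

(** * Configurations and quadratic forms *)

Definition flip n (i : 'I_n) (x : config n) : config n :=
  [ffun j => if j == i then ~~ x j else x j].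

Lemma flipK n (i : 'I_n) : involutive (flip i).
Proof.
move=> x; apply/ffunP => j; rewrite !ffunE.
by case: eqP => // _; rewrite negbK.
Qed.

Lemma sum_flip (V : nmodType) n (i : 'I_n) (F : config n -> V) :
  \sum_x F (flip i x) = \sum_x F x.
Proof. by rewrite [RHS](reindex_inj (inv_inj (@flipK n i))). Qed.

Section QuadraticForm.
Variables (R : realType) (n : nat).
Implicit Types (x : config n) (i j : 'I_n) (A : 'M[R]_n).

Definition spin x i : R := (-1) ^+ x i.

Lemma spin_flip x i j :
  spin (flip i x) j = if j == i then - spin x j else spin x j.
Proof. by rewrite /spin ffunE; case: eqP => // _; rewrite signrN. Qed.

Lemma spin_sqr x i : spin x i * spin x i = 1.
Proof. by rewrite -expr2 sqrr_sign. Qed.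

Lemma normr_spin x i : `|spin x i| = 1.
Proof. exact: normr_sign. Qed.

Definition local_field A x i : R := \sum_j A i j * spin x j.

Definition quad A x : R := \sum_i spin x i * local_field A x i.

Lemma quadE A x : ((spins R x)^T *m A *m spins R x) 0 0 = quad A x.
Proof.
rewrite -mulmxA mxE; apply: eq_bigr => i _; rewrite !mxE; congr (_ * _).
by apply: eq_bigr => j _; rewrite !mxE.
Qed.

Lemma local_field_flip A x i r :
  local_field A (flip i x) r = local_field A x r - 2 * A r i * spin x i.
Proof.
rewrite /local_field (bigD1 i) //= [in RHS](bigD1 i) //= spin_flip eqxx.
rewrite (eq_bigr (fun j => A r j * spin x j)); first by ring.
by move=> j /negPf ji; rewrite spin_flip ji.
Qed.

Lemma quad_flip A x i : is_interaction_mx A ->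
  quad A (flip i x) = quad A x - 4 * (spin x i * local_field A x i).
Proof.
move=> [symA A0].
have colE : \sum_(j | j != i) spin x j * A j i = local_field A x i.
  rewrite /local_field [RHS](bigD1 i) //= A0 mul0r add0r; apply: eq_bigr => j _.
  by rewrite mulrC -[in LHS]symA mxE.
rewrite /quad (bigD1 i) //= [in RHS](bigD1 i) //= spin_flip eqxx local_field_flip A0.
rewrite (eq_bigr (fun j => spin x j * local_field A x j
                           - 2 * spin x i * (spin x j * A j i))).
  by rewrite sumrB -mulr_sumr colE; ring.
by move=> j /negPf ji; rewrite spin_flip ji local_field_flip; ring.
Qed.

Lemma quad_sum k (s : 'I_k -> R) (B : 'I_k -> 'M[R]_n) x :
  quad (\sum_l s l *: B l) x = \sum_l s l * quad (B l) x.
Proof.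
rewrite /quad; under [RHS]eq_bigr do rewrite mulr_sumr.
rewrite exchange_big /=; apply: eq_bigr => i _.
under [RHS]eq_bigr => l _ do rewrite mulrCA.
rewrite -mulr_sumr; congr (_ * _); rewrite /local_field.
under [RHS]eq_bigr do rewrite mulr_sumr.
rewrite exchange_big /=; apply: eq_bigr => j _.
rewrite summxE mulr_suml; apply: eq_bigr => l _.
by rewrite mxE mulrA.
Qed.

End QuadraticForm.

(** * Matrix norms *)

Section MatrixNorms.
Variables (R : realType) (n : nat).
Implicit Types (A B C J : 'M[R]_n).

Definition mxdot (A B : 'M[R]_n) : R := \sum_i \sum_j A i j * B i j.

Lemma norm_frob_sqr A : norm_frob A ^+ 2 = mxdot A A.
Proof.
rewrite sqr_sqrtr //.
by do 2!(apply: sumr_ge0 => ? _); exact: sqr_ge0.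
Qed.

Lemma mxdotC (A B : 'M[R]_n) : mxdot A B = mxdot B A.
Proof.
rewrite /mxdot; apply: eq_bigr => i _; apply: eq_bigr => j _; exact: mulrC.
Qed.

Lemma mxdotBl (A B C : 'M[R]_n) : mxdot (A - B) C = mxdot A C - mxdot B C.
Proof.
rewrite -sumrB; apply: eq_bigr => i _; rewrite -sumrB; apply: eq_bigr => j _.
by rewrite !mxE mulrBl.
Qed.

Lemma mxdotZl c (A B : 'M[R]_n) : mxdot (c *: A) B = c * mxdot A B.
Proof.
rewrite mulr_sumr; apply: eq_bigr => i _; rewrite mulr_sumr.
by apply: eq_bigr => j _; rewrite mxE mulrA.
Qed.

Lemma mxdot_disjoint (A B : 'M[R]_n) :
  [disjoint mx_support A & mx_support B]%B -> mxdot A B = 0.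
Proof.
move=> dAB; rewrite /mxdot big1 // => i _; rewrite big1 // => j _.
have [->|Aij] := eqVneq (A i j) 0; first by rewrite mul0r.
have := disjointFr dAB (x := (i, j)); rewrite !inE /= Aij => /(_ isT).
by move=> /negbFE/eqP ->; rewrite mulr0.
Qed.

Lemma row_sum_le J i : \sum_j `|J i j| <= norm_inf J.
Proof. exact: (le_bigmax _ (fun i => \sum_j `|J i j|)). Qed.

Lemma norm_inf_scale c (A : 'M[R]_n) : norm_inf (c *: A) <= `|c| * norm_inf A.
Proof.
apply: bigmax_le => [|i _].
  by rewrite mulr_ge0 // /norm_inf; apply: bigmax_ge_id.
under eq_bigr do rewrite mxE normrM.
by rewrite -mulr_sumr ler_wpM2l // row_sum_le.
Qed.

(** This is the bound of the operator norm of a symmetric matrix by its largest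
    absolute row sum (Schur test): [u_i v_j <= (u_i^2 + v_j^2) / 2], then the
    sum over the free index is a row sum or, by symmetry, a column sum. *)
Lemma bilinear_le J (u v : 'I_n -> R) : J^T = J ->
  \sum_i \sum_j J i j * (u i * v j) <=
  norm_inf J * ((\sum_i u i ^+ 2 + \sum_i v i ^+ 2) / 2).
Proof.
move=> symJ.
apply: (@le_trans _ _ (\sum_i \sum_j `|J i j| * ((u i ^+ 2 + v j ^+ 2) / 2))).
  apply: ler_sum => i _; apply: ler_sum => j _.
  apply: le_trans (ler_norm _) _; rewrite normrM ler_wpM2l //.
  rewrite normrM -(real_normK (num_real (u i))) -(real_normK (num_real (v j))).
  by have := sqr_ge0 (`|u i| - `|v j|); rewrite sqrrB; lra.
under eq_bigr => i _ do
  under eq_bigr => j _ do rewrite mulrDl mulrDr.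
under eq_bigr => i _ do rewrite big_split.
rewrite big_split /= mulrDl mulrDr lerD //.
  rewrite mulr_suml mulr_sumr; apply: ler_sum => i _.
  by rewrite -mulr_suml ler_wpM2r ?row_sum_le // divr_ge0 ?sqr_ge0.
rewrite exchange_big mulr_suml mulr_sumr; apply: ler_sum => j _ /=.
rewrite -mulr_suml ler_wpM2r ?divr_ge0 ?sqr_ge0 //.
rewrite (eq_bigr (fun i => `|J j i|)) ?row_sum_le // => i _.
by rewrite -[in LHS]symJ mxE.
Qed.

End MatrixNorms.

(** * Expectations under the Ising measure *)

Section IsingMeasure.
Variables (R : realType) (n : nat).
Implicit Types (x : config n) (i r : 'I_n) (J : 'M[R]_n) (f g : config n -> R).

Lemma ising_weightE J x : ising_weight J x = expR (quad J x / 2).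
Proof. by rewrite /ising_weight quadE. Qed.

Lemma ising_weight_gt0 J x : 0 < ising_weight J x.
Proof. exact: expR_gt0. Qed.

Lemma partition_gt0 J : 0 < \sum_y ising_weight J y.
Proof.
rewrite (bigD1 [ffun=> false]) //= ltr_pwDl ?ising_weight_gt0 //.
by apply: sumr_ge0 => x _; rewrite ltW ?ising_weight_gt0.
Qed.

Lemma ising_prob_gt0 J x : 0 < ising_prob J x.
Proof. by rewrite divr_gt0 ?ising_weight_gt0 ?partition_gt0. Qed.

Lemma sum_ising_prob J : \sum_x ising_prob J x = 1.
Proof. by rewrite -mulr_suml divff // gt_eqF // partition_gt0. Qed.

Lemma ln_ising_prob J x :
  ln (ising_prob J x) = quad J x / 2 - ln (\sum_y ising_weight J y).
Proof.
by rewrite ln_div ?posrE ?ising_weight_gt0 ?partition_gt0 // ising_weightE expRK.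
Qed.

Lemma expectD J f g : ising_expectation J (fun x => f x + g x) =
  ising_expectation J f + ising_expectation J g.
Proof. by rewrite -big_split /=; apply: eq_bigr => x _; rewrite mulrDr. Qed.

Lemma expectZ J c f : ising_expectation J (fun x => c * f x) =
  c * ising_expectation J f.
Proof. by rewrite mulr_sumr; apply: eq_bigr => x _; rewrite mulrCA. Qed.

Lemma expect_cst J c : ising_expectation J (fun=> c) = c.
Proof. by rewrite /ising_expectation -mulr_suml sum_ising_prob mul1r. Qed.

Lemma expect_sum J (I : finType) (f : I -> config n -> R) :
  ising_expectation J (fun x => \sum_l f l x) =
  \sum_l ising_expectation J (f l).
Proof.
rewrite exchange_big /=; apply: eq_bigr => x _.
by rewrite mulr_sumr.
Qed.

Lemma le_expect J f g : (forall x, f x <= g x) ->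
  ising_expectation J f <= ising_expectation J g.
Proof.
by move=> fg; apply: ler_sum => x _; rewrite ler_wpM2l // ltW // ising_prob_gt0.
Qed.

(** The conditional expectation of [spin R x i] given the other spins; for an
    interaction matrix it equals [tanh (local_field J x i)].  Written with
    weights, its invariance under [flip i] and [expect_spin] are algebraic identities. *)
Definition cond_mean J x i : R :=
  spin R x i * ((ising_weight J x - ising_weight J (flip i x)) /
              (ising_weight J x + ising_weight J (flip i x))).

Lemma cond_mean_flip J x i : cond_mean J (flip i x) i = cond_mean J x i.
Proof.
rewrite /cond_mean flipK spin_flip eqxx mulNr -mulrN -mulNr opprB.
by rewrite [X in _ / X]addrC.
Qed.

(** Pairing [x] with [flip i x] averages [spin R x i] over the two values of the
    spin at [i], while [g] stays constant on each pair. *)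
Lemma expect_spin J i g : (forall x, g (flip i x) = g x) ->
  ising_expectation J (fun x => spin R x i * g x) =
  ising_expectation J (fun x => cond_mean J x i * g x).
Proof.
move=> gi; apply/eqP; rewrite -subr_eq0 -sumrB; apply/eqP.
set F := (F in \sum_x F x); apply: (@mulfI _ (2 : R)) => //.
rewrite mulr0 mulr_natl mulr2n -[X in X + _](sum_flip i) -big_split big1 //= => x _.
rewrite /F cond_mean_flip spin_flip eqxx gi /ising_prob /cond_mean.
have := ising_weight_gt0 J x; have := ising_weight_gt0 J (flip i x).
have := partition_gt0 J.
move: (\sum_y _) (ising_weight _ _) (ising_weight _ _) => Z u v Z0 u0 v0.
by field; rewrite !gt_eqF ?addr_gt0.
Qed.

(** The quotient is [- tanh (a / 2)]. *)
Lemma normr_tanh_le (a : R) : `|(1 - expR a) / (1 + expR a)| <= `|a|.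
Proof.
have pos b : b <= 0 -> `|(1 - expR b) / (1 + expR b)| <= `|b| :> R.
  move=> b0; have eb := expR_gt0 b; have eb1 := expR_ge1Dx b.
  have eb2 : expR b <= 1 by rewrite -expR0 ler_expR.
  rewrite (ler0_norm b0) ger0_norm ?divr_ge0 ?subr_ge0 ?addr_ge0 ?(ltW eb) //.
  by rewrite ler_pdivrMr ?addr_gt0 //; nra.
have [/pos//|/ltW a0] := leP a 0.
have := pos (- a); rewrite oppr_le0 normrN expRN => /(_ a0); congr (_ <= _).
rewrite -normrN; congr `|_|.
have := expR_gt0 a; move: (expR a) => e e0.
by field; rewrite !gt_eqF ?addr_gt0.
Qed.

(** The sharp inequality is [|tanh h| <= |h|]; losing a factor 2 makes
    [1 + a <= expR a] sufficient. *)
Lemma normr_cond_mean_le J x i : is_interaction_mx J ->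
  `|cond_mean J x i| <= 2 * `|local_field J x i|.
Proof.
move=> HJ; rewrite normrM normr_spin mul1r.
have -> : ising_weight J (flip i x) =
    ising_weight J x * expR (- 2 * (spin R x i * local_field J x i)).
  by rewrite !ising_weightE quad_flip // -expRD; congr expR; field.
set a := - 2 * _; have -> : 2 * `|local_field J x i| = `|a|.
  by rewrite /a !normrM normrN normr_spin mul1r normr_nat.
suff -> : (ising_weight J x - ising_weight J x * expR a) /
    (ising_weight J x + ising_weight J x * expR a) =
    (1 - expR a) / (1 + expR a) by exact: normr_tanh_le.
have := ising_weight_gt0 J x; have := expR_gt0 a.
move: (expR _) (ising_weight _ _) => e w e0 w0.
by field; rewrite !gt_eqF ?addr_gt0 ?mulr_gt0.
Qed.

End IsingMeasure.

(** * Mean energy at high temperature *)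

Section MeanEnergy.
Variables (R : realType) (n : nat).
Implicit Types (i r : 'I_n) (J : 'M[R]_n).

(** Only the part of [local_field J x r] that does not involve the spin at [i]
    is invariant under [flip i]; the remaining part [J r i * spin R x i] meets
    [spin R x i] and produces [J r i], which is the source of [J r i ^+ 2]. The
    inequality drops [- J r i ^+ 2 * E (cond_mean ^+ 2)]. *)
Lemma expect_spin_field J i r : is_interaction_mx J ->
  J r i * ising_expectation J (fun x => spin R x i * local_field J x r) <=
  J r i ^+ 2 +
  ising_expectation J (fun x => J r i * (cond_mean J x i * local_field J x r)).
Proof.
move=> HJ; set t := cond_mean J; set h := local_field J.
have hE x : spin R x i * h x r = J r i + spin R x i * (h x r - J r i * spin R x i).
  by have := spin_sqr R x i; move: (spin R x i) => s s2; ring: s2.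
have -> : ising_expectation J (fun x => spin R x i * h x r) =
    J r i + ising_expectation J (fun x => t x i * (h x r - J r i * spin R x i)).
  rewrite -expect_spin; last first.
    by move=> x; rewrite /h local_field_flip spin_flip eqxx; ring.
  rewrite -[X in X + _](expect_cst J) -expectD.
  by congr ising_expectation; apply/funext => x; rewrite -hE.
have -> : ising_expectation J (fun x => t x i * (h x r - J r i * spin R x i)) =
    ising_expectation J (fun x => t x i * h x r) -
    J r i * ising_expectation J (fun x => t x i * t x i).
  rewrite -(expect_spin J (g := fun x => t x i)); last by move=> x; exact: cond_mean_flip.
  rewrite -mulNr -expectZ -expectD.
  by congr ising_expectation; apply/funext => x; ring.
rewrite expectZ mulrDr mulrBr expr2 lerD2l lerBlDr lerDl mulrA -expr2.
rewrite mulr_ge0 ?sqr_ge0 // -(expect_cst J 0) le_expect // => x.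
by rewrite -expr2 sqr_ge0.
Qed.

(** The second moment of the field is bounded by itself: one spin is replaced
    by its conditional mean [t] in every term [J r i * spin R x i * h r] of
    [|h|^2], where [h = local_field J x], and the resulting form
    [h^T J t] is controlled by [bilinear_le] together with
    [|t|^2 <= 4 |h|^2]. *)
Lemma expect_field_sqr J : is_interaction_mx J ->
  (1 - 5 / 2 * norm_inf J) *
    ising_expectation J (fun x => \sum_i local_field J x i ^+ 2) <=
  norm_frob J ^+ 2.
Proof.
move=> HJ; set t := cond_mean J; set h := local_field J.
set N := ising_expectation _ _.
suff : N <= norm_frob J ^+ 2 + (5 / 2 * norm_inf J) * N by lra.
apply: (@le_trans _ _ (norm_frob J ^+ 2 + ising_expectation J
    (fun x => \sum_r \sum_i J r i * (h x r * t x i)))).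
  rewrite norm_frob_sqr /N expect_sum /mxdot expect_sum -big_split /=.
  apply: ler_sum => r _; rewrite expect_sum -big_split /=.
  have -> : ising_expectation J (fun x => h x r ^+ 2) =
      \sum_i J r i * ising_expectation J (fun x => spin R x i * h x r).
    under [RHS]eq_bigr do rewrite -expectZ.
    rewrite -expect_sum; congr ising_expectation; apply/funext => x.
    rewrite expr2 {1}/h /local_field mulr_suml; apply: eq_bigr => i _.
    by rewrite mulrA.
  apply: ler_sum => i _; rewrite -expr2.
  have := expect_spin_field i r HJ; congr (_ <= _ + _).
  by congr ising_expectation; apply/funext => x; rewrite [h x r * _]mulrC.
rewrite lerD2l /N -expectZ le_expect // => x.
apply: le_trans (bilinear_le _ _ HJ.1) _.
have th : \sum_i t x i ^+ 2 <= 4 * \sum_i h x i ^+ 2.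
  rewrite mulr_sumr; apply: ler_sum => i _.
  have := normr_cond_mean_le x i HJ; rewrite -/(t x i) -/(h x i).
  rewrite -(real_normK (num_real (t x i))) -(real_normK (num_real (h x i))).
  by have := normr_ge0 (t x i); nra.
have J0 : 0 <= norm_inf J by exact: bigmax_ge_id.
rewrite [5 / 2 * _]mulrC -mulrA ler_wpM2l //; lra.
Qed.

(** In [spin R x i * local_field J x i] the field does not involve the spin at
    [i], which can be replaced by its conditional mean, at most twice the
    field. *)
Lemma expect_quad_le J : is_interaction_mx J -> norm_inf J <= 8^-1 ->
  ising_expectation J (quad J) <= 3 * norm_frob J ^+ 2.
Proof.
move=> HJ Jle.
apply: (@le_trans _ _ (2 * ising_expectation J
    (fun x => \sum_i local_field J x i ^+ 2))); last first.
  have := expect_field_sqr HJ; have := sqr_ge0 (norm_frob J).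
  have : 0 <= ising_expectation J (fun x => \sum_i local_field J x i ^+ 2).
    rewrite -[X in X <= _](expect_cst J) le_expect // => x.
    by apply: sumr_ge0 => i _; exact: sqr_ge0.
  by nra.
rewrite /quad !expect_sum mulr_sumr; apply: ler_sum => i _.
rewrite expect_spin; last first.
  by move=> x; rewrite local_field_flip HJ.2 mulr0 mul0r subr0.
rewrite -expectZ le_expect // => x.
have := normr_cond_mean_le x i HJ.
move: (cond_mean J x i) (local_field J x i) => t h.
rewrite -(real_normK (num_real h)) => th.
apply: le_trans (ler_norm _) _; rewrite normrM.
by have := normr_ge0 h; nra.
Qed.

End MeanEnergy.

(** * Assouad bound with averaged divergences *)

Section Assouad.
Variable R : realType.

(** The symmetrized Kullback-Leibler divergence (Jeffreys divergence). *)
Definition sym_kl (X : finType) (p q : X -> R) : R :=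
  \sum_x (p x - q x) * (ln (p x) - ln (q x)).

(** The left side is a lower bound for [2 * |e| * min p q], the cost of not
    knowing which of [e] and [- e] is the target.  For [q <= p],
    [ln p - ln q >= 1 - q / p] gives
    [(p - q) * (ln p - ln q) >= (p - q) ^+ 2 / p >= (p - q) - p / 4]. *)
Lemma two_point (p q a e : R) : 0 < p -> 0 < q ->
  `|e| * (3 / 4 * (p + q) - (p - q) * (ln p - ln q)) <=
  p * `|a - e| + q * `|a + e|.
Proof.
wlog pq : p q e / q <= p => [H p0 q0 | p0 q0].
  have [/H|/ltW /H] := leP q p; first exact.
  move=> /(_ (- e) q0 p0); rewrite normrN opprK; congr (_ <= _); last by rewrite addrC.
  by congr (_ * _); ring.
have lnpq : (p - q) / p <= ln p - ln q.
  rewrite -ln_div ?posrE // -[X in _ <= ln X]invrK lnV ?posrE ?invr_gt0 ?divr_gt0 //.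
  rewrite invf_div lerNr.
  have := @le_ln1Dx R (q / p - 1); rewrite subrKC.
  have -> : - ((p - q) / p) = q / p - 1 by field; rewrite gt_eqF.
  by apply; have : 0 < q / p := divr_gt0 q0 p0; lra.
have pqD : (p - q) - p / 4 <= (p - q) * (ln p - ln q).
  apply: le_trans (ler_wpM2l _ lnpq); last by rewrite subr_ge0.
  rewrite mulrA ler_pdivlMr //.
  by have := sqr_ge0 (p / 2 - (p - q)); nra.
have tri : 2 * `|e| <= `|a - e| + `|a + e|.
  have := ler_normB (a - e) (a + e).
  have -> : a - e - (a + e) = - (2 * e) by ring.
  by rewrite normrN normrM normr_nat.
move: (ln p - ln q) pqD => l pqD.
apply: (@le_trans _ _ (`|e| * (2 * q))).
  by rewrite ler_wpM2l //; lra.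
apply: (@le_trans _ _ ((`|a - e| + `|a + e|) * q)).
  by rewrite mulrA [_ * 2]mulrC ler_wpM2r // ltW.
by rewrite mulrDl [_ * q]mulrC [`|a + e| * q]mulrC lerD2r ler_wpM2r.
Qed.

(** Coordinate [i] of [s] is tested on the pairs [s], [flip i s]; reindexing by
    the flip counts every pair twice.  The divergence enters linearly,
    so that only its sum over the edges of the hypercube matters. *)
Lemma assouad_kl (X : finType) k (P : config k -> X -> R)
    (a : 'I_k -> X -> R) (e : R) :
  (forall s x, 0 < P s x) -> (forall s, \sum_x P s x = 1) -> 0 <= e ->
  e * (3 / 2 * (k%:R * #|config k|%:R) -
       \sum_i \sum_s sym_kl (P s) (P (flip i s))) <=
  2 * \sum_i \sum_s \sum_x P s x * `|a i x - e * spin R s i|.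
Proof.
move=> P0 P1 e0.
have -> : k%:R * #|config k|%:R = \sum_(i < k) \sum_(s : config k) 1 :> R.
  by rewrite !sumr_const card_ord -mulrnA mulnC natrM.
rewrite mulr_sumr -sumrB !mulr_sumr; apply: ler_sum => i _.
have -> (y : R) : 2 * y = y + y by ring.
rewrite -[X in _ <= _ + X](sum_flip i) -sumrB mulr_sumr -big_split.
apply: ler_sum => s _ /=.
have -> : 3 / 2 * 1 = \sum_x 3 / 4 * (P s x + P (flip i s) x) :> R.
  by rewrite -mulr_sumr big_split /= !P1; field.
rewrite -sumrB mulr_sumr -big_split; apply: ler_sum => x _ /=.
have := two_point (a i x) (e * spin R s i) (P0 s x) (P0 (flip i s) x).
rewrite normrM normr_spin mulr1 ger0_norm // spin_flip eqxx.
by rewrite mulrN opprK.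
Qed.

End Assouad.

(** * Signed sums of a family of matrices *)

Section SignedSum.
Variables (R : realType) (n k : nat).
Implicit Types (s : config k) (B : 'I_k -> 'M[R]_n) (A : 'M[R]_n).

Definition signed_sum B s : 'M[R]_n := \sum_i spin R s i *: B i.

Lemma signed_sum_interaction B s : (forall i, is_interaction_mx (B i)) ->
  is_interaction_mx (signed_sum B s).
Proof.
move=> HB; split=> [|i].
  rewrite /signed_sum raddf_sum; apply: eq_bigr => i _.
  by rewrite [LHS]linearZ /= (HB i).1.
by rewrite summxE big1 // => j _; rewrite mxE (HB j).2 mulr0.
Qed.

Lemma norm_inf_signed_sum B s (r : R) : 0 <= r ->
  (forall l, norm_inf (B l) <= r) ->
  norm_inf (signed_sum B s) <= k%:R * r.
Proof.
move=> r0 HB; apply: bigmax_le => [|i _]; first by rewrite mulr_ge0.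
apply: (@le_trans _ _ (\sum_l \sum_j `|B l i j|)).
  rewrite exchange_big; apply: ler_sum => j _ /=.
  rewrite summxE; apply: le_trans (ler_norm_sum _ _ _) _; apply: ler_sum => l _.
  by rewrite mxE normrM normr_spin mul1r.
apply: (@le_trans _ _ (\sum_(l < k) r)); last by rewrite sumr_const card_ord mulr_natl.
by apply: ler_sum => l _; exact: le_trans (row_sum_le _ _) (HB l).
Qed.

(** The log-likelihood ratio between [s] and [flip i s] is
    [spin R s i * quad (B i) x] up to a constant that the difference of two
    probabilities cancels.  Since [flip i s] carries the opposite sign at [i],
    both measures contribute equally after reindexing by the flip, and the terms
    recombine into the energy of [signed_sum B s]. *)
Lemma sum_sym_kl B :
  \sum_i \sum_s sym_kl (ising_prob (signed_sum B s))
                       (ising_prob (signed_sum B (flip i s))) =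
  2 * \sum_s ising_expectation (signed_sum B s) (quad (signed_sum B s)).
Proof.
have klE i s : sym_kl (ising_prob (signed_sum B s))
                      (ising_prob (signed_sum B (flip i s))) =
    ising_expectation (signed_sum B s) (fun x => spin R s i * quad (B i) x) +
    ising_expectation (signed_sum B (flip i s))
      (fun x => spin R (flip i s) i * quad (B i) x).
  set P := ising_prob _; set Q := ising_prob _.
  pose c := ln (\sum_y ising_weight (signed_sum B (flip i s)) y) -
            ln (\sum_y ising_weight (signed_sum B s) y).
  transitivity (\sum_x ((P x * (spin R s i * quad (B i) x) +
      Q x * (spin R (flip i s) i * quad (B i) x)) + (P x - Q x) * c)).
    apply: eq_bigr => x _.
    have -> : ln (P x) - ln (Q x) = spin R s i * quad (B i) x + c.
      rewrite !ln_ising_prob !quad_sum /c.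
      rewrite (bigD1 i) //= [X in _ - (X / 2 - _)](bigD1 i) //=.
      rewrite [X in _ - ((_ + X) / 2 - _)](eq_bigr (fun l => spin R s l * quad (B l) x)).
        by rewrite spin_flip eqxx; field.
      by move=> l /negPf li; rewrite spin_flip li.
    by rewrite spin_flip eqxx; ring.
  by rewrite !big_split /= -mulr_suml sumrB !sum_ising_prob subrr mul0r addr0.
under eq_bigr => i _.
  under eq_bigr do rewrite klE.
  rewrite big_split /=.
  rewrite (sum_flip i (fun s => ising_expectation (signed_sum B s)
      (fun x => spin R s i * quad (B i) x))) -mulr2n -mulr_natl.
  over.
rewrite -mulr_sumr exchange_big; congr (_ * _); apply: eq_bigr => s _ /=.
rewrite -expect_sum; congr ising_expectation; apply/funext => x.
by rewrite quad_sum.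
Qed.

Lemma mxdot_signed B s A :
  mxdot (signed_sum B s) A = \sum_i spin R s i * mxdot (B i) A.
Proof.
under [RHS]eq_bigr do rewrite -mxdotZl.
rewrite /mxdot [RHS]exchange_big; apply: eq_bigr => i _ /=.
rewrite [RHS]exchange_big; apply: eq_bigr => j _ /=.
by rewrite summxE mulr_suml.
Qed.

Definition frob_orthonormal B := forall i j, mxdot (B i) (B j) = (i == j)%:R.

Lemma mxdot_signed_unit B s i : frob_orthonormal B ->
  mxdot (signed_sum B s) (B i) = spin R s i.
Proof.
move=> oB; rewrite mxdot_signed (bigD1 i) //= oB eqxx mulr1 big1 ?addr0 //.
by move=> j /negPf ji; rewrite oB ji mulr0.
Qed.

Lemma mxdot_signed_signed B s : frob_orthonormal B ->
  mxdot (signed_sum B s) (signed_sum B s) = k%:R.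
Proof.
move=> oB; rewrite mxdot_signed.
rewrite (eq_bigr (fun=> 1)) ?sumr_const ?card_ord // => i _.
by rewrite mxdotC mxdot_signed_unit // spin_sqr.
Qed.

(** With [s] the signs of the coordinates of [A] and [T] their [l^1] norm, the
    squared distance from [A] to [(T / k) *: signed_sum B s] equals
    [norm_frob A ^+ 2 - T ^+ 2 / k]. *)
Lemma sum_mxdot_le B A : frob_orthonormal B ->
  \sum_i `|mxdot A (B i)| <= Num.sqrt k%:R * norm_frob A.
Proof.
move=> oB; set T := \sum_i _.
have [k0|k0] := posnP k.
  rewrite [T]big1 ?mulr_ge0 ?sqrtr_ge0 // => i _.
  by have := ltn_ord i; rewrite [X in (_ < X)%N]k0.
pose s : config k := [ffun i => mxdot A (B i) < 0].
have AW : mxdot A (signed_sum B s) = T.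
  rewrite mxdotC mxdot_signed; apply: eq_bigr => i _.
  by rewrite mxdotC /spin ffunE normrEsign.
have kR : 0 < k%:R :> R by rewrite ltr0n.
set W := signed_sum B s in AW.
have := sqr_ge0 (norm_frob (A - (T / k%:R) *: W)).
rewrite norm_frob_sqr mxdotBl mxdotZl (mxdotC A) (mxdotC W) !mxdotBl !mxdotZl.
rewrite (mxdotC W A) AW mxdot_signed_signed // -norm_frob_sqr => dist_ge0.
rewrite -(@ler_pXn2r _ 2) ?nnegrE ?mulr_ge0 ?sqrtr_ge0 ?sumr_ge0 //.
rewrite exprMn sqr_sqrtr ?ler0n // mulrC -ler_pdivrMr // -subr_ge0.
suff -> : norm_frob A ^+ 2 - T ^+ 2 / k%:R = norm_frob A ^+ 2 - T / k%:R * T -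
  T / k%:R * (T - T / k%:R * k%:R) by [].
by field; rewrite gt_eqF.
Qed.

Lemma frob_orthonormal_normalize (J : 'I_k -> 'M[R]_n) :
  (forall i j, i != j -> [disjoint mx_support (J i) & mx_support (J j)]%B) ->
  (forall i, 0 < norm_frob (J i)) ->
  frob_orthonormal (fun i => (norm_frob (J i))^-1 *: J i).
Proof.
move=> dJ J0 i j; rewrite mxdotZl mxdotC mxdotZl.
have [<-|ij] := eqVneq i j.
  by rewrite -norm_frob_sqr expr2 mulKf ?mulVf // gt_eqF.
by rewrite mxdotC mxdot_disjoint ?mulr0 // dJ.
Qed.

End SignedSum.

(** * Lower bound *)

(** The scale [8^-1] is small enough both for [expect_quad_le] and for the
    divergences, which by [sum_sym_kl] average to at most [2 * 3 / 64] over the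
    pairs [(s, i)], against the [3 / 2] of [assouad_kl]. *)
Lemma sum_expect_norm_frob_ge (R : realType) (n k : nat) (U : 'I_k -> 'M[R]_n)
    (Jhat : config n -> 'M[R]_n) :
  frob_orthonormal U -> (forall i, is_interaction_mx (U i)) ->
  (forall i, norm_inf (U i) <= k%:R^-1) ->
  k%:R * #|config k|%:R / 16 <=
  Num.sqrt k%:R * \sum_s ising_expectation (8^-1 *: signed_sum U s)
    (fun x => norm_frob (Jhat x - 8^-1 *: signed_sum U s)).
Proof.
move=> oU HU Uinf; set N := #|config k|%:R.
pose B i := 8^-1 *: U i.
have BE s : 8^-1 *: signed_sum U s = signed_sum B s.
  by rewrite /signed_sum scaler_sumr; apply: eq_bigr => i _; rewrite !scalerA mulrC.
pose a i x := mxdot (Jhat x) (U i).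
have quadB s : ising_expectation (signed_sum B s) (quad (signed_sum B s)) <=
    3 / 64 * k%:R.
  apply: le_trans (expect_quad_le _ _) _.
  - apply: signed_sum_interaction => i; split.
      by rewrite linearZ /= (HU i).1.
    by move=> j; rewrite mxE (HU i).2 mulr0.
  - rewrite -BE; apply: le_trans (norm_inf_scale _ _) _.
    rewrite ger0_norm // ler_piMr //.
    apply: le_trans (norm_inf_signed_sum s _ Uinf) _; rewrite ?invr_ge0 //.
    have [->|k0] := posnP k; first by rewrite mul0r.
    by rewrite divff // pnatr_eq0 -lt0n.
  rewrite norm_frob_sqr -BE mxdotZl mxdotC mxdotZl mxdot_signed_signed //.
  lra.
have := @assouad_kl R _ k (fun s => ising_prob (signed_sum B s)) a 8^-1
  (fun s => ising_prob_gt0 _) (fun s => sum_ising_prob _).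
rewrite sum_sym_kl invr_ge0 ler0n => /(_ isT) H.
have sumq : \sum_s ising_expectation (signed_sum B s) (quad (signed_sum B s))
    <= 3 / 64 * (k%:R * N).
  apply: le_trans (ler_sum _ (fun s _ => quadB s)) _.
  by rewrite sumr_const mulrA [_ * N]mulr_natr.
set E := (X in _ <= 2 * X) in H.
apply: (@le_trans _ _ E).
  have kN : 0 <= k%:R * N by rewrite mulr_ge0.
  by move: H sumq; rewrite -/N; lra.
rewrite mulr_sumr /E exchange_big; apply: ler_sum => s _ /=.
rewrite exchange_big mulr_sumr; apply: ler_sum => x _ /=.
rewrite BE -mulr_sumr mulrCA ler_wpM2l ?(ltW (ising_prob_gt0 _ _)) //.
apply: le_trans (sum_mxdot_le _ oU); apply: ler_sum => i _.
by rewrite mxdotBl -BE mxdotZl mxdot_signed_unit.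
Qed.

Theorem corollary8 (R : realType) :
  exists c : R, 0 < c /\
  forall (n k : nat) (J : 'I_k -> 'M[R]_n),
    (1 <= k)%N ->
    (forall i : 'I_k, is_interaction_mx (J i)) ->
    (forall i j : 'I_k, i != j ->
       [disjoint mx_support (J i) & mx_support (J j)]%B) ->
    (forall i : 'I_k, norm_inf (J i) <= 1) ->
    (forall i : 'I_k, k%:R <= norm_frob (J i)) ->
    forall Jhat : config n -> 'M[R]_n,
      ((c * Num.sqrt k%:R)%:E <=
       ereal_sup [set (ising_expectation Jstar
                         (fun x => norm_frob (Jhat x - Jstar)%R))%:E
                 | Jstar in ising_family J])%E.
Proof.
exists 16^-1; split; first by rewrite invr_gt0.
move=> n k J k_gt0 HJ dJ Jinf Jfrob Jhat.
have kR : 0 < k%:R :> R by rewrite ltr0n.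
have J0 i : 0 < norm_frob (J i) := lt_le_trans kR (Jfrob i).
pose U i := (norm_frob (J i))^-1 *: J i.
have oU : frob_orthonormal U by exact: frob_orthonormal_normalize.
have HU i : is_interaction_mx (U i).
  split=> [|j]; first by rewrite linearZ /= (HJ i).1.
  by rewrite mxE (HJ i).2 mulr0.
have Uinf i : norm_inf (U i) <= k%:R^-1.
  apply: le_trans (norm_inf_scale _ _) _.
  rewrite ger0_norm ?invr_ge0 ?(ltW (J0 i)) //.
  apply: (@le_trans _ _ (norm_frob (J i))^-1); last by rewrite lef_pV2 ?posrE.
  by rewrite ler_piMr // invr_ge0 ltW.
pose Js s := 8^-1 *: signed_sum U s.
have JsE s : ising_family J (Js s).
  split.
    exists (fun i => 8^-1 * (spin R s i / norm_frob (J i))).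
    rewrite /Js scaler_sumr; apply: eq_bigr => i _.
    by rewrite !scalerA mulrA.
  apply: le_trans (norm_inf_scale _ _) _.
  have := norm_inf_signed_sum s (r := k%:R^-1) _ Uinf.
  by rewrite divff ?gt_eqF // invr_ge0 ler0n ger0_norm // => /(_ isT); lra.
pose v s := ising_expectation (Js s) (fun x => norm_frob (Jhat x - Js s)).
have [s vs] : exists s, 16^-1 * Num.sqrt k%:R <= v s.
  apply/existsP; apply: contraT; rewrite negb_exists => /forallP small.
  have := sum_expect_norm_frob_ge Jhat oU HU Uinf; rewrite leNgt => /negP[].
  have sk : 0 < Num.sqrt k%:R :> R by rewrite sqrtr_gt0.
  have -> : k%:R * #|config k|%:R / 16 =
      Num.sqrt k%:R * \sum_(s : config k) 16^-1 * Num.sqrt k%:R :> R.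
    transitivity (Num.sqrt k%:R *
        (16^-1 * Num.sqrt k%:R * #|config k|%:R) : R).
      by rewrite -[X in X * _ / _](sqr_sqrtr (ltW kR)); field.
    by rewrite sumr_const mulr_natr.
  rewrite ltr_pM2l //; apply: ltr_sum => [|s _]; last by rewrite ltNge small.
  by apply/hasP; exists [ffun=> false]; rewrite ?mem_index_enum.
apply: (@le_trans _ _ (v s)%:E); first by rewrite lee_fin.
by apply: ereal_sup_ubound; exists (Js s).
Qed.
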